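(* Let $n$ be a positive integer and let $\lambda,\mu,\nu$ be partitions such that $\ell(\lambda)\le n$ and $\mu,\nu\subseteq\lambda$ with $|\lambda|=|\mu|+|\nu|$. For each $T\in\mathcal{LR}(\lambda/\mu,\nu)$ let $S$ be the partner tableau of $T$. Then $S$ is a Littlewood--Richardson tableau and $S\in\mathcal{LR}(\lambda/\nu,\mu)$.
   Context: Partitions and tableaux. A partition $\lambda=(\lambda_1\ge\lambda_2\ge\cdots)$ has $\ell(\lambda)$ positive parts and weight $|\lambda|=\sum_i\lambda_i$; trailing zeros may be added. $\mu\subseteq\lambda$ means $\mu_i\le\lambda_i$ for all $i$. $D(\lambda)=\{(i,j):1\le i\le\ell(\lambda),1\le j\le\lambda_i\}$ is its Young diagram, row $i$ counted from the top and column $j$ from the left; a corner is a cell whose removal leaves the Young diagram of a partition. A tableau $T$ of shape $\lambda/\mu$ (outer shape $\lambda$, inner shape $\mu$, $\mu\subseteq\lambda$) is a map $D(\lambda)\setminus D(\mu)\to\{1,2,\dots\}$, extended by $T(i,j)=0$ (''empty cell'') for $(i,j)\in D(\mu)$. Its weight is the sequence whose $s$-th term is the number of entries $s$. $T$ is semistandard if its positive entries weakly increase from left to right along rows and strictly increase down columns. $T$ has the lattice permutation property if for all $r\ge1$, $s\ge2$ the number of entries $s$ in the first $r$ rows is at most the number of entries $s-1$ in the first $r-1$ rows. A Littlewood--Richardson (LR) tableau is one that is semistandard and has the lattice permutation property. $\mathcal{LR}(\lambda/\mu,\nu)$ is the set of LR tableaux of shape $\lambda/\mu$ and weight $\nu$.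 Deletion operators. Let $T$ be an LR tableau of shape $\lambda/\mu$ and $(r,\lambda_r)$ a corner of $D(\lambda)$. The deletion operator $\delta_{r,\lambda_r}$ acts on $T$ as follows. (i) If $T(r,\lambda_r)=r$, the cell $(r,\lambda_r)$ is removed, and the terminating row number is $0$. (ii) If $0<T(r,\lambda_r)<r$, remove the cell $(r,\lambda_r)$ with its entry $c_r$; then for $s=r-1,r-2,\dots$ let $c_{s+1}$ replace the rightmost entry of row $s$ (zeros included) that is strictly less than $c_{s+1}$, and call the replaced entry $c_s$; stop as soon as $c_s=0$. The terminating row number is the row $k=s$ in which this happens; the outer shape loses $(r,\lambda_r)$ and the inner shape loses its corner $(k,\mu_k)$. (iii) If $T(r,\lambda_r)=0$, the cell $(r,\lambda_r)=(r,\mu_r)$ is removed from both outer and inner shapes, and the terminating row number is $r$. Full $r$-deletion. If $T$ is an LR tableau with outer shape $\lambda$ and $\ell(\lambda)=r$, then $\delta_r=\delta_{r,1}\delta_{r,2}\cdots\delta_{r,\lambda_r}$, with $\delta_{r,\lambda_r}$ acting first and $\delta_{r,1}$ last. If $\ell(\lambda)<r$, $\delta_r$ does nothing. Partner tableau. For an LR tableau $T$ with outer shape $\lambda$, $\ell(\lambda)\le n$, set $T^{(n)}=T$ and $T^{(r-1)}=\delta_rT^{(r)}$ for $r=n,n-1,\dots,1$. The partner tableau $S$ of $T$ is the filling of $D(\lambda)$ whose row $r$ consists, from left to right, of the $\lambda_r$ terminating row numbers (including zeros) of the operations constituting $\delta_r$ applied to $T^{(r)}$, in order of occurrence; cells containing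 $0$ are regarded as empty (inner-shape) cells. *)

(* Defs.v *)
From mathcomp Require Import all_boot.

Set Implicit Arguments.
Unset Strict Implicit.
Unset Printing Implicit Defensive.

(* A partition is a nonincreasing sequence; trailing zeros are allowed, so
   partitions are only ever compared through their parts [part s i].
   Rows, columns and parts are all numbered from 1. *)
Definition is_partition (s : seq nat) : bool := sorted geq s.
Definition part (s : seq nat) (i : nat) : nat := nth 0 s i.-1.
Definition part_length (s : seq nat) : nat := count (fun x => 0 < x) s.
Definition part_weight (s : seq nat) : nat := sumn s.
Definition part_sub (mu lam : seq nat) : Prop :=
  forall i, 0 < i -> part mu i <= part lam i.

(* A tableau of shape lam/mu is the list of its rows, where the cells of the
   inner shape mu are included and filled with 0.  Both shapes can be read off
   the rows: lam_i is the length of row i and mu_i its number of zeros.  Empty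
   rows may follow the last nonempty one, like trailing zeros in lam. *)
Definition tableau := seq (seq nat).

Definition row (T : tableau) (i : nat) : seq nat := nth [::] T i.-1.
Definition entry (T : tableau) (i j : nat) : nat := nth 0 (row T i) j.-1.
Definition set_row (T : tableau) (i : nat) (w : seq nat) : tableau :=
  set_nth [::] T i.-1 w.

Definition has_shape (lam mu : seq nat) (T : tableau) : Prop :=
  forall i, 0 < i ->
    size (row T i) = part lam i /\
    (forall j, 0 < j <= part lam i -> (entry T i j == 0) = (j <= part mu i)).

(* [entry] is 0 outside the outer shape, so positive entries are in it. *)
Definition semistandard (T : tableau) : Prop :=
  (forall i j j', 0 < i -> 0 < j -> j < j' ->
     0 < entry T i j -> 0 < entry T i j' -> entry T i j <= entry T i j') /\
  (forall i i' j, 0 < i -> i < i' -> 0 < j ->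
     0 < entry T i j -> 0 < entry T i' j -> entry T i j < entry T i' j).

Definition num_entries (s r : nat) (T : tableau) : nat :=
  count_mem s (flatten (take r T)).

Definition lattice_permutation (T : tableau) : Prop :=
  forall r s, 1 <= r -> 2 <= s ->
    num_entries s r T <= num_entries s.-1 r.-1 T.

Definition has_weight (nu : seq nat) (T : tableau) : Prop :=
  forall s, 0 < s -> count_mem s (flatten T) = part nu s.

Definition LR_tableau (lam mu : seq nat) (T : tableau) : Prop :=
  [/\ has_shape lam mu T, semistandard T & lattice_permutation T].

Definition LR (lam mu nu : seq nat) (T : tableau) : Prop :=
  LR_tableau lam mu T /\ has_weight nu T.

(* Zero-based position of the rightmost entry of w that is less than c. *)
Definition rightmost_lt (c : nat) (w : seq nat) : nat :=
  last 0 [seq j <- iota 0 (size w) | nth 0 w j < c].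

(* The replacements in rows s, s-1, ... starting from c = c_(s+1), with the
   terminating row number.  Overwriting the last 0 of row k removes the corner
   (k, mu_k) from the inner shape.  For LR tableaux a replaceable entry always
   exists and the process stops at a positive row; other values are
   conventional. *)
Fixpoint bump (s c : nat) (T : tableau) : tableau * nat :=
  if s is s'.+1 then
    let w := row T s in
    let j := rightmost_lt c w in
    let d := nth 0 w j in
    let T' := set_row T s (set_nth 0 w j c) in
    if d == 0 then (T', s) else bump s' d T'
  else (T, 0).

(* delta_(r, lam_r), with the terminating row number. *)
Definition deletion (r : nat) (T : tableau) : tableau * nat :=
  let w := row T r in
  let c := last 0 w in
  let T' := set_row T r (take (size w).-1 w) in
  if c == r then (T', 0)
  else if c == 0 then (T', r)
  else bump r.-1 c T'.

(* m successive deletions in row r, with the terminating row numbers in order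
   of occurrence. *)
Fixpoint deletions (m r : nat) (T : tableau) : tableau * seq nat :=
  if m is m'.+1 then
    let (T1, k) := deletion r T in
    let (T2, ks) := deletions m' r T1 in
    (T2, k :: ks)
  else (T, [::]).

(* delta_r, for T with at most r nonempty rows; if there are fewer than r, the
   number lam_r of deletions is 0. *)
Definition full_deletion (r : nat) (T : tableau) : tableau * seq nat :=
  deletions (size (row T r)) r T.

(* Applied to T^(r), this returns rows 1, ..., r of the partner tableau. *)
Fixpoint partner (r : nat) (T : tableau) : tableau :=
  if r is r'.+1 then
    let (T', ks) := full_deletion r T in
    rcons (partner r' T') ks
  else [::].

(* Main.v *)
Require Import Defs.
From mathcomp Require Import all_boot zify.

Set Implicit Arguments.
Unset Strict Implicit.
Unset Printing Implicit Defensive.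

(** Number rows from 0 and record a tableau by its content: [a i x] is the
    number of entries [x] in row [i].  For tableaux with weakly increasing rows,
    semistandardness and the lattice property are inequalities between partial
    sums of [a] ([lr_content]).

    One deletion starting in row [r] traces a path [c]: [c i] is the entry
    pushed out of row [i], the largest one below [c i.+1], and [c] is 0 from
    the terminating row upwards ([bump_path]).  In content terms row [i] loses
    one [c i] and gains one [c i.+1].  Such a step preserves the LR conditions
    ([bp_lr_content]), and within one full deletion the paths decrease pointwise
    ([bump_path_mono]), so the terminating row numbers weakly increase: the rows
    of the partner [S] are weakly increasing.  Since only a zero leaves the
    tableau along a path, the inner shape of [S] is read off the weight of [T],
    and the weight of [S] off the zeros of [T].

    The lattice property of [S] says that the inner shapes before and after a
    full deletion differ by a horizontal strip.  This holds because terminating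
    rows weakly increase: when a path shortens [mu] in row [i], row [i.+1] still
    has its initial number of zeros ([bump_chain_strip]).

    Column strictness of [S] compares two consecutive full deletions, from row
    [r.+1] and then from row [r].  For a threshold [x] let [alpha x i] and
    [beta x i] count the paths of the first and of the second with [x < c i],
    plus the deletions that terminate in row number 0.  At [x = 0] these are the
    numbers of entries at most [i] in the two rows of [S], so the claim is
    [alpha 0 i.+1 <= beta 0 i].  It is proved for all [x] by descending
    induction ([bumped_column]).  Passing from [x.+1] to [x], a full deletion
    obeys [alpha x i = min (alpha x.+1 i.+1) (alpha x.+1 i + a i x.+1)]: the
    paths gained are those that push an [x.+1] out of row [i]; each path that
    arrives with a value above [x.+1] and leaves with one at most [x.+1] does so
    while row [i] has one left.  With [e] and [e'] the numbers of [x.+1] in row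
    [i] before and after the first deletion, [beta x i] is the smaller of
    [beta x.+1 i.+1 >= alpha x.+1 i.+2 >= alpha x i.+1] and
    [beta x.+1 i + e' >= alpha x.+1 i.+1 + e' >= alpha x i.+1],
    where the last inequality is the balance of the [x.+1] in row [i] combined
    with [alpha x i <= alpha x.+1 i + e]. *)

(** * Contents of LR tableaux *)

Definition row_le (a : nat -> nat -> nat) (i x : nat) : nat :=
  \sum_(y < x.+1) a i y.
Definition col_sum (a : nat -> nat -> nat) (s i : nat) : nat :=
  \sum_(j < i) a j s.

Lemma row_le0 a i : row_le a i 0 = a i 0.
Proof. by rewrite /row_le big_ord1. Qed.

Lemma row_leS a i x : row_le a i x.+1 = row_le a i x + a i x.+1.
Proof. by rewrite /row_le big_ord_recr. Qed.

Lemma col_sum0 a s : col_sum a s 0 = 0.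
Proof. by rewrite /col_sum big_ord0. Qed.

Lemma col_sumS a s i : col_sum a s i.+1 = col_sum a s i + a i s.
Proof. by rewrite /col_sum big_ord_recr. Qed.

Lemma row_le_mono a i x y : x <= y -> row_le a i x <= row_le a i y.
Proof.
by move/subnK <-; elim: (y - x) => // d IH; rewrite addSn row_leS; lia.
Qed.

Lemma row_le_gt0 a i x y : y <= x -> 0 < a i y -> 0 < row_le a i x.
Proof.
move=> le_yx; rewrite /row_le (bigD1 (Ordinal (le_yx : y < x.+1))) //=; lia.
Qed.

Lemma row_le_lt a i x y : x < y -> 0 < a i y -> row_le a i x < row_le a i y.
Proof.
case: y => // y lt_xy; rewrite row_leS.
by have := row_le_mono a i (lt_xy : x <= y); lia.
Qed.

(** LR conditions for the entries at most [b] of a tableau with [m] rows.  In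
    [lr_cols], the predecessor is truncated so that [x = 0] expresses that the
    inner shape is a partition, and [x > 0] column strictness.  The bound [b]
    allows row [r] to lose entries at its right end during a full deletion, by
    treating them as values above [b]. *)
Record lr_content (m b : nat) (a : nat -> nat -> nat) : Prop := LRContent {
  lr_rows : forall i x, m <= i -> x <= b -> a i x = 0;
  lr_cols : forall i x, x <= b -> row_le a i.+1 x <= row_le a i x.-1;
  lr_lat : forall s i, 0 < s < b -> col_sum a s.+1 i.+1 <= col_sum a s i }.

Lemma lr_content_ext m b a a' :
  (forall i x, x <= b -> a' i x = a i x) ->
  lr_content m b a -> lr_content m b a'.
Proof.
move=> e lra.
have re i x : x <= b -> row_le a' i x = row_le a i x.
  by move=> ?; apply: eq_bigr => y _; apply: e; have := ltn_ord y; lia.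
have ce s i : s <= b -> col_sum a' s i = col_sum a s i.
  by move=> ?; apply: eq_bigr => y _; apply: e.
split.
- by move=> i x *; rewrite e // (lr_rows lra).
- by move=> i x h; rewrite !re ?(lr_cols lra) //; lia.
- by move=> s i h; rewrite !ce ?(lr_lat lra) //; lia.
Qed.

Lemma lr_content_leq m b b' a :
  b' <= b -> lr_content m b a -> lr_content m b' a.
Proof.
by move=> le [h1 h2 h3]; split=> *; [apply: h1|apply: h2|apply: h3]; lia.
Qed.

(** An entry [s] needs an entry [s.-1] strictly higher up, hence at least
    [s.-1] rows above it. *)
Lemma lr_entry_le m b a s i :
  lr_content m b a -> i < s <= b -> col_sum a s i = 0.
Proof.
move=> [_ _ lat]; elim: i s => [|i IH] [|[|s]] // lt_is; rewrite ?col_sum0 //.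
apply/eqP; rewrite -leqn0; apply: leq_trans (lat s.+1 i _) _; first lia.
by rewrite IH //; lia.
Qed.

Lemma lr_entry0 m b a s i :
  lr_content m b a -> i.+1 < s <= b -> a i s = 0.
Proof.
move=> lra h; have := lr_entry_le lra h.
by rewrite col_sumS; lia.
Qed.

(** * The path of one deletion *)

(** The value [r.+1] below row [r] plays the part of infinity: removing the
    last cell of row [r] amounts to replacing its entry by [r.+1], which is
    invisible to entries at most [r].  This makes the exchange [bp_count] and
    the greedy choice [bp_le], [bp_mem], [bp_gap] uniform in all rows.  The
    predecessor in [bp_le] covers both the strict decrease along the path and
    the zeros following its termination. *)
Record bump_path (r : nat) (a : nat -> nat -> nat) (c : nat -> nat)
    (a' : nat -> nat -> nat) : Prop := BumpPath {
  bp_top : forall i, r < i -> c i = r.+1;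
  bp_le : forall i, i <= r -> c i <= (c i.+1).-1;
  bp_mem : forall i, i <= r -> 0 < c i.+1 -> 0 < a i (c i);
  bp_gap : forall i y, c i < y < c i.+1 -> a i y = 0;
  bp_count : forall i x, x <= r ->
    a' i x + (x == c i) = a i x + (x == c i.+1) }.

Section OnePath.
Variables (r : nat) (a a' : nat -> nat -> nat) (c : nat -> nat).
Hypothesis P : bump_path r a c a'.

Lemma bp_bound i : i <= r.+1 -> c i <= i.
Proof.
move=> le_ir; rewrite -(subKn le_ir).
elim: (r.+1 - i) (leq_subr i r.+1) => [|d IH] led.
  by rewrite subn0 (bp_top P).
have := bp_le P (i := r.+1 - d.+1) ltac:(lia).
have -> : (r.+1 - d.+1).+1 = r.+1 - d by lia.
by have := IH (ltnW led); lia.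
Qed.

Lemma bp_mono i : c i <= c i.+1.
Proof.
case: (leqP i r) => h; first by have := bp_le P h; lia.
by rewrite !(bp_top P) // ltnW.
Qed.

Lemma bp_lt i : i <= r -> 0 < c i.+1 -> c i < c i.+1.
Proof. by move=> h; have := bp_le P h; lia. Qed.

Lemma bp_le_top i : c i <= r.+1.
Proof.
case: (leqP i r) => h; first by have := bp_bound (leqW h); lia.
by rewrite (bp_top P).
Qed.

Lemma bp_row_le i x : x <= r ->
  row_le a' i x + (c i <= x) = row_le a i x + (c i.+1 <= x).
Proof.
elim: x => [|x IH] le_xr.
  by rewrite !row_le0 !leqn0 ![_ == 0]eq_sym (bp_count P).
rewrite !row_leS; have := IH (ltnW le_xr).
by have := bp_count P i le_xr; lia.
Qed.

Lemma bp_col_sum s i : 0 < s <= r -> col_sum a' s i = col_sum a s i + (s == c i).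
Proof.
move=> hs; elim: i => [|i IH].
  by rewrite !col_sum0; have := bp_bound (leq0n r.+1); lia.
rewrite !col_sumS IH; have := bp_count P i (x := s) ltac:(lia); lia.
Qed.

Lemma bp_row_le_gap i x y : c i <= x -> x <= y -> y < c i.+1 ->
  row_le a i y = row_le a i x.
Proof.
move=> lecx lexy; rewrite -(subnK lexy); elim: (y - x) => [//|d IH] lt.
rewrite addSn row_leS IH; last lia.
by rewrite (bp_gap P) //; lia.
Qed.

(** Both LR conditions can only fail where the path tightens them, and there
    they were strict before.  Columns: if row [i] loses an entry at most
    [x.-1], then either row [i.+1] loses an [x] as well, or the entry
    [c i.+1 > x] of row [i.+1] witnesses the strictness, because row [i] has no
    entries strictly between [c i] and [c i.+1].  Lattice: a value [s.+1] moves
    up from row [i.+1] to row [i]; either an [s] moves up from row [i], or row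
    [i] has no [s], and the inequality one row lower, which counts the moving
    entry, is the strict inequality needed. *)
Lemma bp_lr_content : lr_content r.+1 r a -> lr_content r.+1 r a'.
Proof.
move=> lra; split.
- move=> i x le_ri le_xr; have := bp_count P i le_xr.
  by rewrite (lr_rows lra) // !(bp_top P); lia.
- move=> i x le_xr.
  have h1 := bp_row_le i.+1 le_xr; have h2 := bp_row_le i (x := x.-1) ltac:(lia).
  have h := lr_cols lra i le_xr.
  have m1 := bp_mono i; have m2 := bp_mono i.+1.
  case: (leqP (c i) x.-1) => lecx; last by lia.
  case: (leqP (c i.+1) x.-1) => ltcx; first by lia.
  have lt_ir : i <= r.
    by case: (leqP i r) => // ?; move: lecx; rewrite (bp_top P) //; lia.
  case: (ltngtP i r) lt_ir => // hir _; last first.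
    (* Row [r.+1] is empty, while row [r] contains [c r]. *)
    have h0 z : z <= r -> row_le a i.+1 z = 0.
      move=> lez; rewrite /row_le big1 // => y _.
      by apply: (lr_rows lra); have := ltn_ord y; lia.
    have := h0 _ le_xr; have : 0 < row_le a i x.-1.
      by apply: row_le_gt0 lecx _; apply: (bp_mem P); lia.
    have := bp_top P (i := i.+1) ltac:(lia).
    have := bp_top P (i := i.+2) ltac:(lia); lia.
  case: (ltngtP (c i.+1) x) => hx; [lia | | ].
    have hb := bp_bound (i := i.+1) ltac:(lia).
    have hc := bp_mem P (i := i.+1) ltac:(lia) ltac:(lia).
    have hg := bp_row_le_gap (y := (c i.+1).-1) lecx ltac:(lia) ltac:(lia).
    have hL := lr_cols lra i (x := c i.+1) ltac:(lia).
    have : row_le a i.+1 x < row_le a i.+1 (c i.+1).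
      by apply: row_le_lt hc.
    lia.
  have := bp_lt (i := i.+1) ltac:(lia) ltac:(lia); lia.
- move=> s i hs; rewrite !bp_col_sum; try lia.
  have h := lr_lat lra i hs.
  case: (eqVneq s.+1 (c i.+1)) => [e|]; last by lia.
  case: (eqVneq s (c i)) => [|ne]; first by lia.
  have le_ir : i < r.
    by case: (ltnP i r) => // ?; move: e; rewrite (bp_top P) //; lia.
  have := bp_lt (i := i) ltac:(lia) ltac:(lia) => lt_c.
  have gap := bp_gap P (i := i) (y := s) ltac:(lia).
  have h' := lr_lat lra i.+1 hs.
  have := bp_mem P (i := i.+1) ltac:(lia); rewrite -e.
  have := bp_mono i.+1.
  by move: h'; rewrite !col_sumS gap; lia.
Qed.
End OnePath.

(** The entry [c i.+1] put into row [i] by the first path is too large for the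
    second, which therefore pushes out an entry that row [i] had from the start
    and that lies below [c i.+1]; the first path took the largest of these. *)
Lemma bump_path_mono r a c a1 c' a2 :
  bump_path r a c a1 -> bump_path r a1 c' a2 -> forall i, c' i <= c i.
Proof.
move=> P P' i; case: (leqP i r) => [le_ir|lt];
  last by rewrite (bp_top P) ?(bp_top P').
have : i <= r.+1 by lia.
rewrite -{2 3}(subKn (leqW le_ir)).
elim: (r.+1 - i) (leq_subr i r.+1) => [|d IH] led _.
  by rewrite subn0 (bp_top P) ?(bp_top P').
set k := r.+1 - d.+1; have ek : r.+1 - d = k.+1 by rewrite /k; lia.
have := IH (ltnW led) ltac:(lia); rewrite ek => le1.
have le_kr : k <= r by rewrite /k; lia.
have h' := bp_le P' le_kr.
case: (posnP (c' k.+1)) => [|pos]; first lia.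
have := bp_mem P' le_kr pos.
have bnd := bp_bound P' (leqW le_kr).
have := bp_count P k (x := c' k) ltac:(lia).
have := bp_gap P (i := k) (y := c' k).
case: (leqP (c' k) (c k)) => //; lia.
Qed.

(** * The paths of a full deletion *)

(** The number of paths that, in the rows above row [i], turn an entry at most
    [x] into one above [x]: for [x <= r] a path does this in exactly one row,
    which is above row [i] if and only if the value coming from row [i] exceeds
    [x]. *)
Definition bumped (cs : seq (nat -> nat)) (x i : nat) : nat :=
  count (fun c => x < c i) cs.

Lemma bumpedS cs x i :
  bumped cs x i = bumped cs x.+1 i + count (fun c => x.+1 == c i) cs.
Proof. by rewrite /bumped; elim: cs => //= c cs ->; lia. Qed.

(** Contents are compared only on entries at most [r], as the other entries of
    row [r] are removed without a path. *)
Inductive bump_chain (r : nat) (a : nat -> nat -> nat) :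
    seq (nat -> nat) -> (nat -> nat -> nat) -> Prop :=
| BumpChain0 a' :
    (forall i x, x <= r -> a' i x = a i x) -> bump_chain r a [::] a'
| BumpChainS c a1 cs a' :
    bump_path r a c a1 -> bump_chain r a1 cs a' -> bump_chain r a (c :: cs) a'.

Lemma bump_path_ext r a b c a' :
  (forall i x, x <= r -> b i x = a i x) ->
  bump_path r b c a' -> bump_path r a c a'.
Proof.
move=> e P; split; [exact: bp_top P | exact: bp_le P | | |].
- move=> i le_ir pos; rewrite -e; first exact: (bp_mem P).
  have := bp_bound P (leqW le_ir); have := bp_le P le_ir.
  by have := bp_le_top P i.+1; lia.
- move=> i y h; rewrite -e; first exact: (bp_gap P).
  by have := bp_le_top P i.+1; lia.
- by move=> i x le_xr; rewrite (bp_count P) ?e.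
Qed.

Lemma bump_chain_ext r a b cs a' :
  (forall i x, x <= r -> b i x = a i x) ->
  bump_chain r b cs a' -> bump_chain r a cs a'.
Proof.
move=> e ch; case: ch => [b' e'|c a1 cs' a2 P ch].
  by constructor=> i x le_xr; rewrite e' ?e.
by apply: BumpChainS ch; apply: bump_path_ext P.
Qed.

Lemma bump_chain_le r a c a1 cs a' i :
  bump_path r a c a1 -> bump_chain r a1 cs a' -> all (fun c' => c' i <= c i) cs.
Proof.
move=> P ch; elim: ch a c P => //= {}a1 c' a2 {}cs {}a' P' ch IH a c P.
have le := bump_path_mono P P' i; rewrite le /=.
by apply: sub_all (IH _ _ P') => c'' le'; apply: leq_trans le' le.
Qed.

Lemma bumped_eq0 cs b x i :
  all (fun c => c i <= b) cs -> b <= x -> bumped cs x i = 0.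
Proof.
by rewrite /bumped => + le_bx; elim: cs => //= c cs IH /andP[le /IH ->]; lia.
Qed.

Section Chain.
Variables (r : nat) (a a' : nat -> nat -> nat) (cs : seq (nat -> nat)).
Hypothesis ch : bump_chain r a cs a'.

Lemma bump_chain_lr : lr_content r.+1 r a -> lr_content r.+1 r a'.
Proof.
elim: ch => [b b' e | b c b1 ds b' P _ IH] lra; first exact: lr_content_ext e lra.
by apply: IH; apply: bp_lr_content P lra.
Qed.

Lemma bumped_top x i : x <= r < i -> bumped cs x i = size cs.
Proof.
elim: ch => //= b c b1 ds b' P _ IH h.
by rewrite /bumped /= -/(bumped _ _ _) IH // (bp_top P); lia.
Qed.

Lemma bumped_low x i : i <= r.+1 -> i <= x -> bumped cs x i = 0.
Proof.
elim: ch => //= b c b1 ds b' P _ IH le_ir le_ix.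
by rewrite /bumped /= -/(bumped _ _ _) IH //; have := bp_bound P le_ir; lia.
Qed.

Lemma bump_chain_count i x : x <= r ->
  a' i x + count (fun c => x == c i) cs = a i x + count (fun c => x == c i.+1) cs.
Proof.
move=> le_xr; elim: ch => [b b' /= -> //| b c b1 ds b' P _ /= IH].
by have := bp_count P i le_xr; lia.
Qed.

Lemma bump_chain_col_sum s : 0 < s <= r -> col_sum a' s r.+1 = col_sum a s r.+1.
Proof.
move=> hs; elim: ch => [b b' e | b c b1 ds b' P _ ->].
  by apply: eq_bigr => y _; apply: e; lia.
by rewrite (bp_col_sum P) // (bp_top P); lia.
Qed.

(** The next three lemmas are the two inequalities behind
    [bumped x i = min (bumped x.+1 i.+1) (bumped x.+1 i + a i x.+1)].  Here the
    strict decrease along a path is used. *)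
Lemma bumped_up x i : x < r -> bumped cs x i <= bumped cs x.+1 i.+1.
Proof.
move=> lt_xr; elim: ch => //= b c b1 ds b' P _ IH.
rewrite /bumped /= -!/(bumped _ _ _); apply: leq_add => //.
case: (leqP i r) => h; first by have := bp_le P h; lia.
by rewrite !(bp_top P); lia.
Qed.

(** As the paths decrease, an [x.+1] arriving in row [i] is never pushed out
    again: all later arrivals are at most [x.+1].  So at most the initial
    [a i x.+1] copies leave. *)
Lemma bumped_exit_le x i :
  i <= r -> x < r -> bumped cs x i <= bumped cs x.+1 i + a i x.+1.
Proof.
move=> le_ir lt_xr; elim: ch => //= b c b1 ds b' P ch1 IH.
rewrite /bumped /= -!/(bumped _ _ _).
have hc := bp_count P i lt_xr; have hle := bp_le P le_ir.
case: (leqP (c i.+1) x.+1) => h; last by lia.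
by rewrite (bumped_eq0 (bump_chain_le i P ch1)); lia.
Qed.

(** If a path arrives in row [i] with a value above [x.+1] and leaves with one
    at most [x], then row [i] has no [x.+1] at that moment, and the earlier
    paths have pushed out all the initial copies. *)
Lemma bumped_exit_ge x i : i <= r -> x < r ->
  bumped cs x.+1 i.+1 <= bumped cs x i \/
  bumped cs x.+1 i + a i x.+1 <= bumped cs x i.
Proof.
move=> le_ir lt_xr; elim: ch => [|b c b1 ds b' P ch1 IH]; first by left.
rewrite /bumped /= -!/(bumped _ _ _).
have hc := bp_count P i lt_xr; have hle := bp_le P le_ir.
have hg := bp_gap P (i := i) (y := x.+1).
case: (leqP (c i.+1) x.+1) => h.
  by left; rewrite (bumped_eq0 (bump_chain_le i.+1 P ch1)) //; lia.
have := bumpedS ds x i.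
case: (leqP x.+1 (c i)) => h'; lia.
Qed.

(** As soon as a path terminates in row [i.+1], all later ones terminate there
    or below, and the zeros of row [i] are final; until then row [i.+1] keeps
    its zeros. *)
Lemma bump_chain_strip i : lr_content r.+1 r a -> a i.+1 0 <= a' i 0.
Proof.
elim: ch => [b b' e|b c b1 ds b' P ch1 IH] lra.
  by rewrite e //; have := lr_cols lra i (x := 0) isT; rewrite !row_le0.
have := IH (bp_lr_content P lra).
have hc := bp_count P i.+1 (leq0n r).
case: (posnP (c i.+1)) => h; last by lia.
have h0 : b' i 0 = b1 i 0.
  have := bump_chain_le i P ch1; have := bump_chain_le i.+1 P ch1.
  have -> : c i = 0 by have := bp_mono P i; lia.
  rewrite h; elim: ch1 {IH} =>  // [d d' ->//|d c' d1 es d' P' ch' IH'] /=.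
  move=> /andP[l1 /IH' {}IH'] /andP[l2 /IH' ->].
  by have := bp_count P' i (leq0n r); lia.
have := lr_cols lra i (x := 0) isT; rewrite !row_le0.
have := bp_count P i (leq0n r); have := bp_mono P i; lia.
Qed.
End Chain.

(** The inequality behind column strictness of the partner.  The terms
    [a r.+1 r.+2] and [a1 r r.+1] count the cells holding their own row number,
    with rows counted from 1, whose deletion terminates at 0. *)
Lemma bumped_column r a cs a1 cs' a2 :
  lr_content r.+2 r.+2 a ->
  bump_chain r.+1 a cs a1 -> bump_chain r a1 cs' a2 ->
  (forall x, x <= r.+1 -> a1 r.+1 x = 0) ->
  a r.+1 r.+2 + size cs <= a1 r r.+1 + size cs' ->
  forall i x, x <= r ->
    a r.+1 r.+2 + bumped cs x i.+1 <= a1 r r.+1 + bumped cs' x i.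
Proof.
move=> lra ch ch' row0 le_size i x le_xr.
have lra1 := bump_chain_lr ch (lr_content_leq (leqnSn _) lra).
have le_z : a r.+1 r.+2 <= a r r.+1.
  have := lr_lat lra (s := r.+1) r.+1 ltac:(lia).
  by rewrite !col_sumS !(lr_entry_le lra) //; lia.
have z' : a1 r r.+1 = a r r.+1 + a r.+1 r.+1.
  have := bump_chain_col_sum ch (s := r.+1) ltac:(lia).
  rewrite !col_sumS row0 // (lr_entry_le lra1) ?(lr_entry_le lra) //; lia.
(* Descending induction on [x], starting from [x = r]. *)
move ed: (r - x) => d; elim/ltn_ind: d x i ed le_xr => d IH x i ed le_xr.
case: (ltngtP x r) le_xr => // hx _; last first.
  (* A path exceeds [r] in no row above row [r.+1], and in row [r.+1] only by
     pushing out an [r.+1], which then stays in row [r]. *)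
  rewrite hx; case: (ltngtP i r) => hi.
  - by rewrite (bumped_low ch); lia.
  - by rewrite (bumped_top ch) ?(bumped_top ch'); lia.
  have := bumped_exit_le ch (x := r) (i := r.+1) ltac:(lia) ltac:(lia).
  by rewrite (bumped_low ch (x := r.+1)) // hi; lia.
have IHx j : a r.+1 r.+2 + bumped cs x.+1 j.+1 <= a1 r r.+1 + bumped cs' x.+1 j.
  by apply: (IH (r - x.+1)); lia.
case: (leqP i r) => hi; last by rewrite (bumped_top ch) ?(bumped_top ch'); lia.
have h1 := IHx i; have h2 := IHx i.+1.
have u1 := bumped_up ch i.+1 (x := x) ltac:(lia).
case: (bumped_exit_ge ch' hi hx) => lo; first by lia.
have hc := bump_chain_count ch i (x := x.+1) ltac:(lia).
have b1 := bumpedS cs x i; have b2 := bumpedS cs x i.+1.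
have u2 := bumped_exit_le ch (i := i) (x := x) ltac:(lia) ltac:(lia).
lia.
Qed.

(** * Bumping in a row *)

Lemma sorted_nth_leq (w : seq nat) i j :
  sorted leq w -> i <= j < size w -> nth 0 w i <= nth 0 w j.
Proof.
move=> sw /andP[le_ij lt_j].
apply: (sorted_leq_nth leq_trans leqnn 0 sw) => //; rewrite inE //.
exact: leq_ltn_trans lt_j.
Qed.

Lemma mem_nthP (w : seq nat) (y : nat) :
  y \in w -> exists2 k, k < size w & nth 0 w k = y.
Proof. by case/(nthP 0) => k lt_k e; exists k. Qed.

Lemma sorted_leq_last (s : seq nat) (y : nat) :
  sorted leq s -> y \in s -> y <= last 0 s.
Proof.
move=> ss /mem_nthP[k lt <-]; rewrite -nth_last.
by apply: sorted_nth_leq => //; lia.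
Qed.

Lemma rightmost_ltP c w :
  sorted leq w -> has (fun y => y < c) w ->
  let j := rightmost_lt c w in
  [/\ j < size w, nth 0 w j < c,
      forall k, j < k < size w -> c <= nth 0 w k
    & forall y, y \in w -> y < c -> y <= nth 0 w j].
Proof.
move=> sw hw j; set s := [seq k <- iota 0 (size w) | nth 0 w k < c].
have ss : sorted leq s.
  by apply: sorted_filter (iota_sorted _ _) => ? ? ?; apply: leq_trans.
have mem_s k : (k \in s) = (k < size w) && (nth 0 w k < c).
  by rewrite mem_filter mem_iota andbC.
have js k : k \in s -> k <= j by apply: sorted_leq_last.
have /andP[lt_j lt_c] : (j < size w) && (nth 0 w j < c).
  rewrite -mem_s /j /rightmost_lt -/s.
  case/(has_nthP 0): hw => k lt_k lt_c.
  have : k \in s by rewrite mem_s lt_k.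
  by case: (s) => //= a t _; rewrite mem_last.
split=> // [k /andP[lt_jk lt_k]|y /mem_nthP[k lt_k <-] lt_y].
  by rewrite leqNgt; apply/negP => lt; have := js k; rewrite mem_s lt_k lt; lia.
by apply: sorted_nth_leq => //; rewrite lt_j andbT; apply: js; rewrite mem_s lt_k.
Qed.

Lemma count_mem_set_nth (w : seq nat) (j c x : nat) :
  j < size w ->
  count_mem x (set_nth 0 w j c) + (x == nth 0 w j) = count_mem x w + (x == c).
Proof. by elim: w j => // y w IH [|j] /=; [lia | by rewrite -!addnA => /IH ->]. Qed.

Lemma sorted_set_rightmost c w :
  sorted leq w -> has (fun y => y < c) w ->
  sorted leq (set_nth 0 w (rightmost_lt c w) c).
Proof.
move=> sw hw; have [] := rightmost_ltP sw hw.
set j := rightmost_lt c w => lt_j lt_c gt_c _.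
apply/(sortedP 0) => i; rewrite size_set_nth (maxn_idPr lt_j) => lt_i.
rewrite !nth_set_nth /=; case: eqP => [ei|nei]; case: eqP => [e|ne] //.
- by rewrite gt_c // -ei; lia.
- apply: leq_trans (ltnW lt_c); rewrite -e.
  by apply: sorted_nth_leq => //; lia.
- by apply: sorted_nth_leq => //; lia.
Qed.

Definition content_of (T : tableau) (i x : nat) : nat :=
  count_mem x (nth [::] T i).

Lemma content_gt0 T i x : (0 < content_of T i x) = (x \in nth [::] T i).
Proof. by rewrite -has_count has_pred1. Qed.

Lemma row_le_content T i x :
  row_le (content_of T) i x = count (fun y => y <= x) (nth [::] T i).
Proof.
rewrite /row_le /content_of; elim: (nth _ _ _) => [|y w IH] /=.
  by rewrite big1.
rewrite big_split /= IH; congr (_ + _).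
case: (leqP y x) => h.
  rewrite (bigD1 (Ordinal (h : y < x.+1))) //= eqxx big1 // => z /eqP ne.
  by case: eqP => // e; case: ne; apply: val_inj.
by rewrite big1 // => z _; have := ltn_ord z; lia.
Qed.

(** * From tableaux to paths *)

(** What [bump] does when [c0] is pushed into row [i.-1]; for [c0 = 0] nothing
    is pushed.  By [br_stop] the terminating row number [k], which counts rows
    from 1, is the number of rows up to row [i] in which the path is 0. *)
Record bump_result (i c0 : nat) (T T' : tableau) (k : nat) (c : nat -> nat) :
    Prop := BumpResult {
  br_start : c i = c0;
  br_le : forall j, j < i -> c j <= (c j.+1).-1;
  br_mem : forall j, j < i -> 0 < c j.+1 -> c j \in nth [::] T j;
  br_gap : forall j y, j < i -> y \in nth [::] T j -> y < c j.+1 -> y <= c j;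
  br_content : forall j x, j < i ->
    content_of T' j x + (x == c j) = content_of T j x + (x == c j.+1);
  br_below : forall j, i <= j -> nth [::] T' j = nth [::] T j;
  br_sorted : forall j, sorted leq (nth [::] T' j);
  br_size : forall j, size (nth [::] T' j) = size (nth [::] T j);
  br_stop : forall j, j <= i -> (k <= j) = (0 < c j);
  br_stop_le : k <= i.+1 }.

(** The last two hypotheses are what semistandardness provides: every row has
    an entry below the value pushed into it. *)
Lemma bump_resultP i c0 T :
  0 < c0 <= i ->
  (forall j, sorted leq (nth [::] T j)) ->
  has (fun y => y < c0) (nth [::] T i.-1) ->
  (forall j y, j.+1 < i -> y \in nth [::] T j.+1 -> 0 < y ->
     has (fun z => z < y) (nth [::] T j)) ->
  exists c, bump_result i c0 T (Defs.bump i c0 T).1 (Defs.bump i c0 T).2 c.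
Proof.
elim: i c0 T => [|i IH] c0 T /andP[c0_gt0 le_c0] sT hw hT; first by lia.
rewrite /Defs.bump -/Defs.bump /row /set_row /=; set w := nth [::] T i in hw *.
have [] := rightmost_ltP (sT i) hw; rewrite -/w.
have sw := sorted_set_rightmost (sT i) hw.
have cw := @count_mem_set_nth w (rightmost_lt c0 w) c0.
set j := rightmost_lt c0 w in sw cw *; set d := nth 0 w j => lt_j lt_d gt_j max_d.
set T1 := set_nth [::] T i (set_nth 0 w j c0).
have T1E l : nth [::] T1 l = if l == i then set_nth 0 w j c0 else nth [::] T l.
  by rewrite nth_set_nth.
have T1lt l : l < i -> nth [::] T1 l = nth [::] T l.
  by move=> ?; rewrite T1E; case: eqP => //; lia.
have sT1 l : sorted leq (nth [::] T1 l) by rewrite T1E; case: eqP.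
have szT1 l : size (nth [::] T1 l) = size (nth [::] T l).
  by rewrite T1E; case: eqP => [->|//]; rewrite size_set_nth (maxn_idPr lt_j).
have dw : d \in w by apply: mem_nth.
have neS l : l < i.+1 -> (l == i.+1) = false by lia.
case: eqP => d0.
  exists (fun l => if l == i.+1 then c0 else 0); split=> /=; rewrite ?eqxx //.
  - by move=> l lt_l; rewrite neS.
  - by move=> l lt_l; rewrite (neS l) // eqSS; case: eqP => // -> _; rewrite -d0.
  - move=> l y lt_l; rewrite (neS l) // ?eqSS.
    by case: eqP => // -> yw lt_y; rewrite -d0; apply: max_d.
  - move=> l x lt_l; rewrite (neS l) // /content_of T1E eqSS.
    case: (eqVneq l i) => [->|//].
    by rewrite -cw // -/d d0.
  - by move=> l lt_l; rewrite T1E; case: eqP => //; lia.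
  - by move=> l; case: eqP; lia.
have [||||c R] := IH d T1; rewrite ?sT1 //.
- by move: d0 lt_d; lia.
- have i_gt0 : 0 < i by move: d0 lt_d; lia.
  by rewrite T1lt ?prednK //; apply: hT; rewrite ?prednK //; move: d0; lia.
- by move=> l y lt_l; rewrite !T1lt //; last lia; apply: hT; lia.
exists (fun l => if l == i.+1 then c0 else c l).
have cS l : l < i.+1 -> (if l == i.+1 then c0 else c l) = c l by move=> /neS ->.
split; rewrite /= ?eqxx //.
- move=> l lt_l; rewrite (cS l) // eqSS; case: (eqVneq l i) => [->|ne].
    by rewrite (br_start R); lia.
  by apply: (br_le R); lia.
- move=> l lt_l; rewrite (cS l) // eqSS; case: (eqVneq l i) => [-> _|ne pos].
    by rewrite (br_start R).
  by rewrite -T1lt; [apply: (br_mem R) | ]; lia.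
- move=> l y lt_l; rewrite (cS l) // eqSS; case: (eqVneq l i) => [->|ne].
    by rewrite (br_start R); apply: max_d.
  by rewrite -T1lt; [apply: (br_gap R) | ]; lia.
- move=> l x lt_l; rewrite (cS l) // eqSS; case: (eqVneq l i) => [->|ne].
    by rewrite (br_start R) /content_of (br_below R) // T1E eqxx cw.
  rewrite (br_content R); last by lia.
  by rewrite /content_of T1lt //; lia.
- move=> l lt_l; rewrite (br_below R) ?T1E; last by lia.
  by case: eqP => //; lia.
- exact: (br_sorted R).
- by move=> l; rewrite (br_size R).
- move=> l le_l; case: eqP => [->|ne]; first by rewrite (br_stop_le R); lia.
  by apply: (br_stop R); lia.
- by have := br_stop_le R; lia.
Qed.

(** The state of the tableau between full deletions: at most [n] rows. *)
Record lr_state (n : nat) (T : tableau) : Prop := LRState {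
  st_sorted : forall i, sorted leq (nth [::] T i);
  st_empty : forall i, n <= i -> nth [::] T i = [::];
  st_bound : forall i y, y \in nth [::] T i -> y <= n;
  st_lr : lr_content n n (content_of T) }.

(** The state during the full deletion of row [r], in which only the LR
    conditions on entries at most [r] persist.  Entries [r.+1] can occur in row
    [r] alone. *)
Record deleting_state (r : nat) (T : tableau) : Prop := DeletingState {
  ds_sorted : forall i, sorted leq (nth [::] T i);
  ds_empty : forall i, r < i -> nth [::] T i = [::];
  ds_bound : forall i y, y \in nth [::] T i -> y <= r + (i == r);
  ds_lr : lr_content r.+1 r (content_of T) }.

Lemma lr_state_deleting r T : lr_state r.+1 T -> deleting_state r T.
Proof.
move=> [sT eT bT lrT]; split=> // [i y yi|].
  have := bT _ _ yi; case: (leqP y r) => [|lt]; first lia.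
  move=> le; have {le lt} ey : y = r.+1 by lia.
  move: yi; rewrite ey -content_gt0; case: (ltngtP i r) => hi; last by lia.
    by rewrite (lr_entry0 lrT) //; lia.
  by rewrite (lr_rows lrT) //; lia.
exact: lr_content_leq lrT.
Qed.

Lemma deleting_lr_state r T :
  deleting_state r T -> nth [::] T r = [::] -> lr_state r T.
Proof.
move=> [sT eT bT lrT] er; have eT' i : r <= i -> nth [::] T i = [::].
  by case: (ltngtP r i) => // [/eT //|<-].
split=> // [i y yi|].
  by have := bT _ _ yi; case: (eqVneq i r) yi => [->|]; rewrite ?er //; lia.
case: lrT => h1 h2 h3.
by split=> *; [rewrite /content_of eT'|apply: h2; lia|apply: h3; lia].
Qed.

(** A corner entry 0 is the path that terminates at once in row [r]; it is
    treated together with proper bumping. *)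
Lemma deletion_step r T w0 c0 T' k :
  deleting_state r T -> nth [::] T r = rcons w0 c0 -> c0 <= r ->
  deletion r.+1 T = (T', k) ->
  exists c, [/\ bump_path r (content_of T) c (content_of T'),
    forall i, (k <= i) = (0 < c i), deleting_state r T',
    forall i, i < r -> size (nth [::] T' i) = size (nth [::] T i)
    & nth [::] T' r = w0].
Proof.
move=> dT eT le_c0; rewrite /deletion /row /set_row /= eT last_rcons size_rcons /=.
rewrite -cats1 take_size_cat // (_ : c0 == r.+1 = false); last by lia.
set T1 := set_nth [::] T r w0.
have T1E i : nth [::] T1 i = if i == r then w0 else nth [::] T i.
  by rewrite nth_set_nth.
have T1lt i : i < r -> nth [::] T1 i = nth [::] T i.
  by move=> ?; rewrite T1E; case: eqP => //; lia.
have sw : sorted leq w0.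
  have := ds_sorted dT r; rewrite eT -cats1.
  by case: (w0) => //= ? ?; rewrite cat_path => /andP[].
have sT1 i : sorted leq (nth [::] T1 i).
  by rewrite T1E; case: eqP => // _; exact: (ds_sorted dT).
move=> eD; have {eD} [c R] : exists c, bump_result r c0 T1 T' k c.
  move: eD; case: eqP => [-> [<- <-]|c0_neq0 eD].
    by exists (fun=> 0); split=> // *; lia.
  have := @bump_resultP r c0 T1; rewrite eD /=; apply=> //; first lia.
    rewrite T1lt; last by lia.
    have := lr_cols (ds_lr dT) r.-1 le_c0.
    rewrite prednK; last by lia.
    rewrite !row_le_content eT -cats1 count_cat /= leqnn => h.
    have : 0 < count (fun y => y <= c0.-1) (nth [::] T r.-1) by lia.
    by rewrite -has_count; apply: sub_has => y /=; lia.
  move=> j y lt_j; rewrite !T1lt // => [yj y_gt0|]; last by lia.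
  have le_y := ds_bound dT yj.
  have := lr_cols (ds_lr dT) j (x := y) ltac:(lia).
  rewrite !row_le_content => h.
  have : 0 < count (fun z => z <= y.-1) (nth [::] T j).
    apply: leq_trans h; rewrite -has_count; apply/hasP; by exists y.
  by rewrite -has_count; apply: sub_has => z /=; lia.
have cr := br_start R.
pose c1 i := if i <= r then c i else r.+1.
have le_c1 i : i <= r -> c1 i = c i by rewrite /c1 => ->.
have lt_c1 i : r < i -> c1 i = r.+1 by rewrite /c1 ltnNge => /negbTE->.
have T'ge i : r < i -> nth [::] T' i = [::].
  by move=> lt; rewrite (br_below R) ?T1E ?gtn_eqF ?(ds_empty dT) // ltnW.
have T'r : nth [::] T' r = w0 by rewrite (br_below R) // T1E eqxx.
have P : bump_path r (content_of T) c1 (content_of T').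
  split=> //.
  - move=> i; case: (ltngtP i r) => // [lt|->] _; last first.
      by rewrite (lt_c1 r.+1) ?(le_c1 r) ?cr.
    by rewrite (le_c1 i.+1) ?(le_c1 i (ltnW lt)) ?(br_le R).
  - move=> i; case: (ltngtP i r) => // [lt|->] _.
      rewrite (le_c1 i.+1) ?(le_c1 i (ltnW lt)) //.
      by rewrite content_gt0 -T1lt // => pos; exact: (br_mem R lt pos).
    by rewrite (le_c1 r) // cr content_gt0 eT mem_rcons mem_head.
  - move=> i y /andP[lt1 lt2]; apply/eqP; rewrite -leqn0 leqNgt content_gt0.
    apply/negP => yi; case: (ltngtP i r) => hi.
    + move: lt1 lt2; rewrite (le_c1 i.+1) ?(le_c1 i (ltnW hi)) // => lt1 lt2.
      by have := br_gap R hi _ lt2; rewrite T1lt // => /(_ yi); lia.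
    + by move: yi; rewrite (ds_empty dT).
    + move: lt1 yi; rewrite hi (le_c1 r) // cr => lt1 yi.
      have := sorted_leq_last (ds_sorted dT r) yi.
      by rewrite eT last_rcons; lia.
  - move=> i x le_x; case: (ltngtP i r) => hi.
    + rewrite (le_c1 i.+1) ?(le_c1 i (ltnW hi)) // (br_content R) //.
      by rewrite /content_of T1lt.
    + rewrite (lt_c1 i.+1) ?(lt_c1 i) ?(leqW hi) //.
      by rewrite /content_of T'ge // (ds_empty dT).
    + rewrite hi (le_c1 r) ?(lt_c1 r.+1) // cr /content_of T'r eT -cats1 count_cat /=.
      by lia.
exists c1; split=> //.
- move=> i; case: (leqP i r) => hi; first by rewrite le_c1 ?(br_stop R).
  by rewrite lt_c1 //; have := br_stop_le R; lia.
- split=> //; first exact: (br_sorted R); last exact: bp_lr_content P (ds_lr dT).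
  move=> i y; case: (ltngtP i r) => hi; last 2 first.
  + by rewrite T'ge.
  + rewrite hi T'r => yw; have := @ds_bound _ _ dT r y.
    by rewrite eqxx eT mem_rcons inE yw orbT => ->.
  rewrite -content_gt0; have := br_content R y hi.
  have e1 : content_of T1 i y = content_of T i y by rewrite /content_of T1lt.
  have := bp_bound P (i := i.+1) ltac:(lia); rewrite (le_c1 i.+1) // => le_c.
  case: (posnP (content_of T i y)) => [z|].
    by lia.
  by rewrite content_gt0 => /(ds_bound dT); lia.
- by move=> i hi; rewrite (br_size R) T1lt.
Qed.

(** The entries [r.+1] end row [r], so they are deleted first, each with
    terminating number 0; afterwards each deletion follows a path. *)
Lemma deletions_spec m r T T' ks :
  deleting_state r T -> size (nth [::] T r) = m ->
  deletions m r.+1 T = (T', ks) ->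
  exists cs, [/\ bump_chain r (content_of T) cs (content_of T'),
    forall i, count (fun k => k <= i) ks =
              content_of T r r.+1 + bumped cs 0 i,
    size ks = m /\ content_of T r r.+1 + size cs = m,
    sorted leq ks
  & lr_state r T' /\
    forall i, i < r -> size (nth [::] T' i) = size (nth [::] T i)].
Proof.
elim: m T ks => [|m IH] T ks dT.
  move/size0nil => eT [<- <-]; exists [::]; rewrite /content_of eT.
  by split=> //; [constructor | split=> //; apply: deleting_lr_state].
case/lastP eT: (nth [::] T r) => [//|w0 c0]; rewrite size_rcons => -[sz] /=.
case eD: (deletion r.+1 T) => [T1 k].
case eDs: (deletions m r.+1 T1) => [T2 ks'] [eT2 <-] {ks}; rewrite {T2}eT2 in eDs.
have c0r : c0 \in nth [::] T r by rewrite eT mem_rcons mem_head.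
have := ds_bound dT c0r; rewrite eqxx => le_c0.
case: (eqVneq c0 r.+1) => [ec0|ne].
  move: eD; rewrite /deletion /row /set_row /= eT last_rcons size_rcons /=.
  rewrite -cats1 take_size_cat // ec0 eqxx => -[eT1 <-].
  have T1E i : nth [::] T1 i = if i == r then w0 else nth [::] T i.
    by rewrite -eT1 nth_set_nth.
  have C1 i x : x <= r -> content_of T1 i x = content_of T i x.
    rewrite /content_of T1E; case: eqP => [->|//].
    by rewrite eT -cats1 count_cat /= ec0; lia.
  have dT1 : deleting_state r T1.
    split.
    - move=> i; rewrite T1E; case: eqP => _; last exact: (ds_sorted dT).
      have := ds_sorted dT r; rewrite eT -cats1.
      by case: (w0) => //= ? ?; rewrite cat_path => /andP[].
    - by move=> i lt; rewrite T1E gtn_eqF ?(ds_empty dT).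
    - move=> i y; rewrite T1E; case: (eqVneq i r) => [_|ne].
        move=> yw; have := @ds_bound _ _ dT r y.
        by rewrite eqxx eT mem_rcons inE yw orbT => ->.
      by move=> yi; have := ds_bound dT yi; rewrite (negbTE ne).
    - exact: lr_content_ext C1 (ds_lr dT).
  have T1r : nth [::] T1 r = w0 by rewrite T1E eqxx.
  have [|cs [ch cnt [sz1 sz2] sks [st szT2]]] := IH T1 ks' dT1 _ eDs.
    by rewrite T1r.
  have z : content_of T r r.+1 = (content_of T1 r r.+1).+1.
    by rewrite /content_of T1r eT -cats1 count_cat /= ec0; lia.
  exists cs; rewrite z; split=> //=.
  - by apply: bump_chain_ext ch.
  - by move=> i; rewrite cnt.
  - by rewrite sz1 addSn sz2.
  - by rewrite path_min_sorted //; apply/allP.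
  - by split=> // i lt; rewrite szT2 // T1E ltn_eqF.
have [|c [P stop dT1 szT1 T1r]] := deletion_step dT eT _ eD; first by lia.
have [|cs [ch cnt [sz1 sz2] sks [st szT2]]] := IH T1 ks' dT1 _ eDs.
  by rewrite T1r.
have z : content_of T r r.+1 = 0.
  apply/eqP; rewrite -leqn0 leqNgt content_gt0; apply/negP => h.
  by have := sorted_leq_last (ds_sorted dT r) h; rewrite eT last_rcons; lia.
have z1 : content_of T1 r r.+1 = 0.
  move: z; rewrite /content_of T1r eT -cats1 count_cat /=; lia.
rewrite z1 in cnt sz2; exists (c :: cs); rewrite z; split=> //=.
- exact: BumpChainS ch.
- by move=> i; rewrite cnt stop /bumped /=; lia.
- by rewrite sz1; split=> //; lia.
- rewrite path_min_sorted //; apply/allP => k' k'in.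
  have : 0 < count (fun k => k <= k') ks' by rewrite -has_count; apply/hasP; exists k'.
  rewrite cnt; case: (leqP k k') => // lt.
  have : c k' <= 0 by have := stop k'; lia.
  move=> c0'; rewrite (bumped_eq0 (b := 0)) //.
  by apply: sub_all (bump_chain_le k' P ch) => c'; lia.
- by split=> // i lt; rewrite szT2 // szT1.
Qed.

(** * The partner tableau *)

Lemma col_sum_content T s N :
  col_sum (content_of T) s N = count_mem s (flatten (take N T)).
Proof.
elim: T N => [|w T IH] [|N]; rewrite /col_sum ?big_ord0 //=.
  by rewrite big1 // => i _; rewrite /content_of nth_nil.
rewrite big_ord_recl count_cat; congr (_ + _).
by rewrite -IH /col_sum; apply: eq_bigr.
Qed.

(** The properties of the partner in terms of the content of [T]: [ps_zeros]
    makes the weight of [T] the inner shape of [S], and [ps_content] makes the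
    inner shape of [T] the weight of [S]. *)
Record partner_spec (r : nat) (T S : tableau) : Prop := PartnerSpec {
  ps_size : forall i, i < r -> size (nth [::] S i) = size (nth [::] T i);
  ps_sorted : forall i, i < r -> sorted leq (nth [::] S i);
  ps_zeros : forall i, i < r ->
    count (fun k => k <= 0) (nth [::] S i) = col_sum (content_of T) i.+1 r;
  ps_cols : forall i x, i.+1 < r ->
    count (fun k => k <= x) (nth [::] S i.+1) <=
    count (fun k => k <= x.-1) (nth [::] S i);
  ps_content : forall s, count_mem s.+1 (flatten S) = content_of T s 0;
  ps_lat : forall i s, 0 < i ->
    num_entries s.+2 i S <= num_entries s.+1 i.-1 S }.

Lemma lr_state_size r T i :
  lr_state r T -> size (nth [::] T i.+1) <= size (nth [::] T i).
Proof.
move=> st; have h j : row_le (content_of T) j r = size (nth [::] T j).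
  rewrite row_le_content; apply/eqP; rewrite -all_count; apply/allP => y.
  exact: (st_bound st).
rewrite -!h; apply: leq_trans (lr_cols (st_lr st) i (leqnn r)) _.
by apply: row_le_mono; lia.
Qed.

Lemma partner_size r T : size (partner r T) = r.
Proof.
elim: r T => //= r IH T; case: (full_deletion _ _) => T' ks.
by rewrite size_rcons IH.
Qed.

Lemma partner_last_columns i r T T1 ks : i.+1 = r -> lr_state r.+1 T ->
  deletions (size (nth [::] T r)) r.+1 T = (T1, ks) ->
  forall x, count (fun k => k <= x) ks <=
            count (fun k => k <= x.-1) (nth [::] (partner r T1) i).
Proof.
move=> <- {r} st eD x.
have [cs [ch cnt [_ sz] _ [st1 szT1]]] :=
  deletions_spec (lr_state_deleting st) erefl eD.
case eD1: (deletions (size (nth [::] T1 i)) i.+1 T1) => [T2 ks1].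
have [cs1 [ch1 cnt1 [_ sz1] _ _]] :=
  deletions_spec (lr_state_deleting st1) erefl eD1.
have -> : nth [::] (partner i.+1 T1) i = ks1.
  by rewrite /= /full_deletion /row /= eD1 nth_rcons partner_size ltnn eqxx.
have row0 y : y <= i.+1 -> content_of T1 i.+1 y = 0.
  by rewrite /content_of (st_empty st1).
have le_sz : content_of T i.+1 i.+2 + size cs <= content_of T1 i i.+1 + size cs1.
  by rewrite sz sz1 szT1 // (lr_state_size _ st).
have col j := bumped_column (st_lr st) ch ch1 row0 le_sz j (leq0n i).
rewrite cnt cnt1; case: x => [|x] /=; last exact: col.
by apply: leq_trans (col 0); rewrite (bumped_low ch) // addn0 leq_addr.
Qed.

Lemma partnerP r T : lr_state r T -> partner_spec r T (partner r T).
Proof.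
elim: r T => [|r IH] T st.
  by split=> //= s; rewrite /content_of (st_empty st).
case eD: (deletions (size (nth [::] T r)) r.+1 T) => [T1 ks].
have -> : partner r.+1 T = rcons (partner r T1) ks.
  by rewrite /= /full_deletion /row /= eD.
have [cs [ch cnt [sz1 sz2] sks [st1 szT1]]] :=
  deletions_spec (lr_state_deleting st) erefl eD.
have IH1 := IH _ st1.
have lr1 := ds_lr (lr_state_deleting st).
set S := partner r T1 in IH1 *.
have sS : size S = r by apply: partner_size.
have nthS i : i < r.+1 ->
    nth [::] (rcons S ks) i = if i == r then ks else nth [::] S i.
  by move=> ?; rewrite nth_rcons sS; case: (ltngtP i r) => //; lia.
have low i : i < r -> (i == r) = false by lia.
have row0 x : content_of T1 r x = 0 by rewrite /content_of (st_empty st1).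
have cs0 : bumped cs 0 0 = 0 by rewrite (bumped_low ch).
(* Of the zeros in row [s], those lost are the ones where a path ends. *)
have cntks s : count_mem s.+1 ks + content_of T1 s 0 = content_of T s 0.
  have := bump_chain_count ch s (leq0n r); have := bumpedS cs 0 0.
  have e i : count (fun c => 0 == c i) cs + bumped cs 0 i = size cs.
    by rewrite /bumped; elim: (cs) => //= c cs' <-; lia.
  have := e s; have := e s.+1.
  have : count (fun k => k <= s.+1) ks =
         count (fun k => k <= s) ks + count_mem s.+1 ks.
    by elim: (ks) => //= k ks' ->; lia.
  rewrite !cnt; lia.
have cntS s : count_mem s.+1 (flatten (rcons S ks)) = content_of T s 0.
  by rewrite -cats1 flatten_cat count_cat /= cats0 (ps_content IH1) addnC cntks.
split=> //.
- move=> i; rewrite ltnS => hi; rewrite nthS //.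
  case: (eqVneq i r) => [->|ne]; first by rewrite sz1.
  by rewrite (ps_size IH1) ?szT1; lia.
- move=> i; rewrite ltnS => hi; rewrite nthS //.
  case: (eqVneq i r) => // ne; apply: (ps_sorted IH1); lia.
- move=> i; rewrite ltnS => hi; rewrite nthS //.
  case: (eqVneq i r) => [->|ne].
    by rewrite cnt cs0 addn0 col_sumS (lr_entry_le (st_lr st)) // ltnSn /=.
  rewrite (ps_zeros IH1); last by lia.
  rewrite -(bump_chain_col_sum ch); last by lia.
  by rewrite col_sumS row0 addn0.
- move=> i x hi; rewrite !nthS //; last by lia.
  rewrite (low i) //; case: (eqVneq i.+1 r) => [er|ne]; last first.
    by apply: (ps_cols IH1); lia.
  exact: (partner_last_columns er st eD).
- case=> // i s _; rewrite /num_entries.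
  case: (ltngtP i r) => hi.
  + by rewrite -!cats1 !takel_cat ?sS //; [apply: (ps_lat IH1) | lia].
  + rewrite !take_oversize ?size_rcons ?sS ?cntS; [| lia..].
    by have := lr_cols (st_lr st) s (x := 0) isT; rewrite !row_le0.
  rewrite hi take_oversize ?size_rcons ?sS // cntS -cats1 takel_cat ?sS //=.
  by rewrite -sS take_size (ps_content IH1); apply: (bump_chain_strip ch).
Qed.

(** * Tableaux and contents *)

(** In a sorted list, the elements satisfying a monotone predicate form an
    initial segment. *)
Lemma sorted_count_nth (e : rel nat) (p : pred nat) (w : seq nat) q :
  transitive e -> (forall x y, e x y -> p y -> p x) -> sorted e w ->
  (q < count p w) = (q < size w) && p (nth 0 w q).
Proof.
move=> etr mono; elim: w q => // y w IH q /= pw.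
case py: (p y); first by case: q => //= q; rewrite -IH ?(path_sorted pw) //.
have /allP aw := order_path_min etr pw.
have np z : z \in y :: w -> ~~ p z.
  rewrite inE => /orP[/eqP->|/aw eyz]; first by rewrite py.
  by apply/negP => /(mono _ _ eyz); rewrite py.
have -> : count p w = 0.
  apply/eqP; rewrite -leqn0 leqNgt -has_count; apply/hasPn => z zw.
  by apply: np; rewrite inE zw orbT.
rewrite ltn0; case: (ltnP q (size w).+1) => //= h.
by apply/esym/negbTE/np; apply: (@mem_nth _ 0 (y :: w)).
Qed.

Lemma count_leq_nth (w : seq nat) x q : sorted leq w ->
  (q < count (fun y => y <= x) w) = (q < size w) && (nth 0 w q <= x).
Proof.
move=> sw; apply: sorted_count_nth sw; first exact: leq_trans.
by move=> y z; apply: leq_trans.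
Qed.

(** Translates column strictness between counting and entries.  With the
    truncated predecessor an entry 0 may only stand below a 0. *)
Lemma strict_columnsP (u v : seq nat) : sorted leq u -> sorted leq v ->
  (forall x, count (fun y => y <= x) v <= count (fun y => y <= x.-1) u) <->
  (forall j, j < size v -> j < size u /\ nth 0 u j <= (nth 0 v j).-1).
Proof.
move=> su sv; split=> [h j lt_j | h x].
  have : j < count (fun y => y <= nth 0 v j) v by rewrite count_leq_nth // lt_j /=.
  by move/leq_trans/(_ (h _)); rewrite count_leq_nth // => /andP.
rewrite leqNgt count_leq_nth //; apply/negP => /andP[/h[lt_q le_q] le_x].
have := ltnn (count (fun y => y <= x.-1) u).
by rewrite {1}count_leq_nth // lt_q /=; lia.
Qed.

Lemma partition_nth lam i : is_partition lam -> nth 0 lam i.+1 <= nth 0 lam i.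
Proof.
move=> pl; case: (leqP (size lam) i.+1) => h; first by rewrite nth_default.
by move/(sortedP 0): pl => /(_ i h).
Qed.

Lemma partition_nth0 lam n i :
  is_partition lam -> part_length lam <= n -> n <= i -> nth 0 lam i = 0.
Proof.
move=> pl le_n le_i.
have := @sorted_count_nth geq (fun x => 0 < x) lam i _ _ pl.
rewrite ltnNge (leq_trans le_n le_i); case: (ltnP i (size lam)) => h; last first.
  by rewrite nth_default.
move=> /= e; case: (posnP (nth 0 lam i)) => // pos.
by rewrite pos in e; have : false by apply: e => [y x z /= ? ?|x y /= ? ?]; lia.
Qed.

Lemma LR_lr_state n lam mu T :
  is_partition lam -> is_partition mu -> part_length lam <= n ->
  LR_tableau lam mu T -> lr_state n T.
Proof.
move=> pl pm len [shT [rT cT] latT].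
have sz i : size (nth [::] T i) = nth 0 lam i by case: (shT i.+1 isT).
have z i j : j < nth 0 lam i -> (nth 0 (nth [::] T i) j == 0) = (j < nth 0 mu i).
  by move=> lt; case: (shT i.+1 isT) => _ /(_ j.+1 lt).
have eT i : n <= i -> nth [::] T i = [::].
  by move=> le; apply: size0nil; rewrite sz (partition_nth0 pl len).
have sT i : sorted leq (nth [::] T i).
  apply/(sortedP 0) => j lt; rewrite sz in lt.
  case: (posnP (nth 0 (nth [::] T i) j)) => [->//|pos].
  apply: (rT i.+1 j.+1 j.+2) => //; rewrite lt0n /entry /row /=.
  by have := z i j ltac:(lia); rewrite (z i j.+1 lt); lia.
have lrT b : lr_content n b (content_of T).
  split=> [i x le _|i x _|s i /andP[s_gt0 _]].
  - by rewrite /content_of eT.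
  - rewrite !row_le_content; move: x; apply/(strict_columnsP (sT i) (sT i.+1)).
    move=> j; rewrite !sz => lt; have lt' := leq_trans lt (partition_nth i pl).
    split=> //; have z1 := z _ _ lt; have z2 := z _ _ lt'.
    have := partition_nth i pm.
    have := cT i.+1 i.+2 j.+1 isT (ltnSn _) isT; rewrite /entry /row /=; lia.
  - by rewrite !col_sum_content; apply: (latT i.+1 s.+1).
split=> // i y yi.
have hi : i < n by rewrite ltnNge; apply/negP => /eT e; rewrite e in yi.
move: yi; rewrite -content_gt0 => pos; case: (leqP y i.+1) => h; first lia.
by move: pos; rewrite (lr_entry0 (lrT y)) // h leqnn.
Qed.

Lemma count_flatten_content n T s : (forall i, n <= i -> nth [::] T i = [::]) ->
  count_mem s (flatten T) = col_sum (content_of T) s n.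
Proof.
move=> eT.
have ext m d : (forall i, m <= i -> nth [::] T i = [::]) ->
    col_sum (content_of T) s (m + d) = col_sum (content_of T) s m.
  move=> e; elim: d => [|d IH]; first by rewrite addn0.
  by rewrite addnS col_sumS IH /content_of e ?addn0 // leq_addr.
rewrite -(ext n (size T)) // addnC ext; last by move=> i; apply: nth_default.
by rewrite col_sum_content take_size.
Qed.

Theorem theorem4p2 (n : nat) (lam mu nu : seq nat) (T : tableau) :
  0 < n ->
  is_partition lam -> is_partition mu -> is_partition nu ->
  part_length lam <= n ->
  part_sub mu lam -> part_sub nu lam ->
  part_weight lam = part_weight mu + part_weight nu ->
  LR lam mu nu T ->
  LR_tableau lam nu (partner n T) /\ LR lam nu mu (partner n T).
Proof.
move=> _ pl pm _ len sub_mu _ _ [lrT wT].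
have st := LR_lr_state pl pm len lrT.
case: lrT => shT _ _.
have sz i : size (nth [::] T i) = nth 0 lam i by case: (shT i.+1 isT).
have P := partnerP st; set S := partner n T in P *.
have S0 i : n <= i -> nth [::] S i = [::]
  by move=> le; rewrite nth_default ?partner_size.
have szS i : size (nth [::] S i) = nth 0 lam i.
  case: (ltnP i n) => h; first by rewrite (ps_size P).
  by rewrite S0 // (partition_nth0 pl len).
have sS i : sorted leq (nth [::] S i).
  by case: (ltnP i n) => h; [apply: (ps_sorted P) | rewrite S0].
have colS i j : j < nth 0 lam i.+1 ->
    nth 0 (nth [::] S i) j <= (nth 0 (nth [::] S i.+1) j).-1.
  move=> lt; have hi : i.+1 < n.
    by rewrite ltnNge; apply/negP => /(partition_nth0 pl len) e; rewrite e in lt.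
  have /(strict_columnsP (sS i) (sS i.+1)) := fun x => ps_cols P x hi.
  by case/(_ j); rewrite ?szS.
suff lrS : LR_tableau lam nu S.
  split=> //; split=> // -[//|s] _; rewrite (ps_content P).
  have ct q : (q < content_of T s 0) = (q < part mu s.+1).
    rewrite -row_le0 row_le_content count_leq_nth ?(st_sorted st) // leqn0 sz.
    case: (shT s.+1 isT) => _ zT; have := sub_mu s.+1 isT.
    rewrite /part /= in zT *; case: (ltnP q (nth 0 lam s)) => h /=; last by lia.
    by move=> _; apply: (zT q.+1).
  by apply/eqP; rewrite eqn_leq leqNgt ct ltnn leqNgt -ct ltnn.
split.
- case=> // i _; split; first exact: szS.
  case=> // j /= lt; rewrite /part /= in lt *.
  have hi : i < n.
    by rewrite ltnNge; apply/negP => /(partition_nth0 pl len) e; rewrite e in lt.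
  have := wT i.+1 isT; rewrite /part /= => <-.
  rewrite (count_flatten_content _ (st_empty st)) /entry /row.
  by rewrite -(ps_zeros P hi) count_leq_nth // szS lt /= leqn0.
- split=> [[//|i] [//|j] [//|j'] _ _ lt _|].
    rewrite /entry /row /= => pos; apply: sorted_nth_leq => //.
    rewrite -ltnS (ltnW lt) /= ltnNge; apply/negP => le.
    by rewrite nth_default in pos.
  move=> [//|i] [//|i'] [//|j] _ lt _; rewrite /entry /row /= => pos pos'.
  have lt_j : j < nth 0 lam i'.
    by rewrite -szS ltnNge; apply/negP => le; rewrite nth_default in pos'.
  rewrite ltnS in lt.
  (* Intermediate cells of the column may be empty, so the induction runs on
     the form of strictness that zeros satisfy too. *)
  suff : nth 0 (nth [::] S i) j <= (nth 0 (nth [::] S i') j).-1 by lia.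
  elim: i' lt lt_j {pos'} => // i' IH.
  rewrite ltnS leq_eqVlt => /orP[/eqP <-|lt] lt_j; first exact: colS.
  have := IH lt (leq_trans lt_j (partition_nth i' pl)).
  by have := colS _ _ lt_j; lia.
- by move=> [//|r] [//|[//|s]] _ _; apply: (ps_lat P).
Qed.
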